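(* Let $V_1=(1,b_1,c_1)$ and $V_2=(1,b_2,c_2)$ in $\mathfrak{se}(2)$ with either $b_1\neq b_2$ or $c_1\neq c_2$. Define the neighborhood of the identity in $\mathrm{SE}(2)$ $$U=\big\{(\theta,x,y)\in\mathrm{SE}(2)\ \big|\ \|(c_1-c_2,b_1-b_2)\|^2\ge\max\{\|(x,y)\|^2,\ 2(1-\cos\theta)\|(b_1,c_1)\|^2\}\big\}.$$ Consider the map $\mathcal{IK}:U\subset\mathrm{SE}(2)\to\mathbb{R}^3$ whose components are $$\mathcal{IK}_1(\theta,x,y)=\operatorname{arctan2}\big(\rho,\sqrt{4-\rho^2}\big)+\operatorname{arctan2}(\alpha,\beta),$$ $$\mathcal{IK}_2(\theta,x,y)=\operatorname{arctan2}\big(2-\rho^2,\rho\sqrt{4-\rho^2}\big),$$ $$\mathcal{IK}_3(\theta,x,y)=\theta-\mathcal{IK}_1(\theta,x,y)-\mathcal{IK}_2(\theta,x,y),$$ where $\rho=\sqrt{\alpha^2+\beta^2}$ and $$\begin{bmatrix}\alpha\\ \beta\end{bmatrix}=\frac{1}{\|(c_1-c_2,b_1-b_2)\|^2}\begin{bmatrix}c_1-c_2&b_2-b_1\\ b_1-b_2&c_1-c_2\end{bmatrix}\left(\begin{bmatrix}x\\ y\end{bmatrix}-\begin{bmatrix}-c_1&b_1\\ b_1&c_1\end{bmatrix}\begin{bmatrix}1-\cos\theta\\ \sin\theta\end{bmatrix}\right).$$ Then $\mathcal{IK}$ is a local right inverse of the map $\mathcal{FK}^{(1,2,1)}:\mathbb{R}^3\to\mathrm{SE}(2)$,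 $\mathcal{FK}^{(1,2,1)}(t_1,t_2,t_3)=\exp(t_1V_1)\exp(t_2V_2)\exp(t_3V_1)$; that is, $\mathcal{FK}^{(1,2,1)}\circ\mathcal{IK}=\mathrm{id}_U:U\to U$.
   Context: Elements of $\mathfrak{se}(2)$ are written $(a,b,c)=a e_\theta+b e_x+c e_y$, where $$e_\theta=\begin{bmatrix}0&-1&0\\ 1&0&0\\ 0&0&0\end{bmatrix},\quad e_x=\begin{bmatrix}0&0&1\\ 0&0&0\\ 0&0&0\end{bmatrix},\quad e_y=\begin{bmatrix}0&0&0\\ 0&0&1\\ 0&0&0\end{bmatrix}.$$ Elements of $\mathrm{SE}(2)$ are written $$(\theta,x,y)\equiv\begin{bmatrix}\cos\theta&-\sin\theta&x\\ \sin\theta&\cos\theta&y\\ 0&0&1\end{bmatrix}.$$ The angle $\theta$ is determined by the group element only modulo $2\pi$; in the formula for $\mathcal{IK}$, $\theta$ is a fixed choice of real representative (for instance in $(-\pi,\pi]$). $\exp$ is the matrix exponential, products are matrix products, and $\|\cdot\|$ is the Euclidean norm. $\operatorname{arctan2}(x,y)$ denotes the arctangent of $y/x$ taking into account the quadrant of the point $(x,y)$ (i.e. the polar angle of $(x,y)$, in $(-\pi,\pi]$), with the convention $\operatorname{arctan2}(0,0)=0$; note the order of arguments. *)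

(* Defs.v *)
From HB Require Import structures.
From mathcomp Require Import all_boot all_order all_algebra.
From mathcomp Require Import all_classical all_reals all_analysis.

Set Implicit Arguments.
Unset Strict Implicit.
Unset Printing Implicit Defensive.

Import Order.TTheory GRing.Theory Num.Theory.
Import numFieldNormedType.Exports.

Local Open Scope classical_set_scope.
Local Open Scope ring_scope.

Section Defs.
Context {R : realType}.

Definition mx_of_rows m n (rows : seq (seq R)) : 'M[R]_(m, n) :=
  \matrix_(i, j) nth 0 (nth [::] rows i) j.

(* Same shape as the library's [expR]: the limit of the exponential series. *)
Definition expmx n (A : 'M[R]_n.+1) : 'M[R]_n.+1 :=
  lim (series (fun k : nat => (k`!%:R)^-1 *: A ^+ k) @ \oo).

(* The library norm `|_| on 'cV[R]_2 is the sup norm, hence this definition. *)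
Definition enorm (x y : R) : R := Num.sqrt (x ^+ 2 + y ^+ 2).

(* Polar angle of the point (x, y), in ]-pi, pi]; abscissa first. *)
Definition arctan2 (x y : R) : R :=
  if 0 < x then atan (y / x)
  else if x < 0 then
    if 0 <= y then atan (y / x) + pi else atan (y / x) - pi
  else if 0 < y then pi / 2
  else if y < 0 then - (pi / 2)
  else 0.

Definition e_theta : 'M[R]_3 :=
  mx_of_rows 3 3 [:: [:: 0; -1; 0]; [:: 1; 0; 0]; [:: 0; 0; 0]].
Definition e_x : 'M[R]_3 :=
  mx_of_rows 3 3 [:: [:: 0; 0; 1]; [:: 0; 0; 0]; [:: 0; 0; 0]].
Definition e_y : 'M[R]_3 :=
  mx_of_rows 3 3 [:: [:: 0; 0; 0]; [:: 0; 0; 1]; [:: 0; 0; 0]].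

Definition se2_mx (a b c : R) : 'M[R]_3 :=
  a *: e_theta + b *: e_x + c *: e_y.

Definition SE2_mx (theta x y : R) : 'M[R]_3 :=
  mx_of_rows 3 3 [:: [:: cos theta; - sin theta; x];
                     [:: sin theta;   cos theta; y];
                     [:: 0;           0;         1]].

Definition SE2 : set 'M[R]_3 :=
  [set g | exists theta x y : R, g = SE2_mx theta x y].

(* A choice, for every element of SE(2), of a real representative of its angle,
   which is only determined modulo 2 pi; x and y are the entries (0, 2) and
   (1, 2) of the matrix. *)
Definition angle_choice (ang : 'M[R]_3 -> R) : Prop :=
  forall g, SE2 g -> g = SE2_mx (ang g) (g 0 2) (g 1 2).

Definition FK121 (V1 V2 : 'M[R]_3) (t : 'rV[R]_3) : 'M[R]_3 :=
  expmx (t 0 0 *: V1) *m expmx (t 0 1 *: V2) *m expmx (t 0 2 *: V1).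

Section IK.
Variables b1 c1 b2 c2 : R.

Definition U_nbhd : set 'M[R]_3 :=
  [set g | exists theta x y : R, g = SE2_mx theta x y /\
     Num.max (enorm x y ^+ 2) (2 * (1 - cos theta) * enorm b1 c1 ^+ 2)
       <= enorm (c1 - c2) (b1 - b2) ^+ 2].

Definition alpha_beta (theta x y : R) : 'cV[R]_2 :=
  (enorm (c1 - c2) (b1 - b2) ^+ 2)^-1 *:
  (mx_of_rows 2 2 [:: [:: c1 - c2; b2 - b1]; [:: b1 - b2; c1 - c2]] *m
   (mx_of_rows 2 1 [:: [:: x]; [:: y]] -
    mx_of_rows 2 2 [:: [:: - c1; b1]; [:: b1; c1]] *m
    mx_of_rows 2 1 [:: [:: 1 - cos theta]; [:: sin theta]])).

Definition IK_alpha (theta x y : R) : R := alpha_beta theta x y 0 0.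
Definition IK_beta (theta x y : R) : R := alpha_beta theta x y 1 0.
Definition IK_rho (theta x y : R) : R :=
  Num.sqrt (IK_alpha theta x y ^+ 2 + IK_beta theta x y ^+ 2).

Definition IK1 (theta x y : R) : R :=
  let rho := IK_rho theta x y in
  arctan2 rho (Num.sqrt (4 - rho ^+ 2)) +
  arctan2 (IK_alpha theta x y) (IK_beta theta x y).

Definition IK2 (theta x y : R) : R :=
  let rho := IK_rho theta x y in
  arctan2 (2 - rho ^+ 2) (rho * Num.sqrt (4 - rho ^+ 2)).

Definition IK3 (theta x y : R) : R :=
  theta - IK1 theta x y - IK2 theta x y.

(* Only meaningful on SE2, where [ang] is an angle choice. *)
Definition IK (ang : 'M[R]_3 -> R) (g : 'M[R]_3) : 'rV[R]_3 :=
  let theta := ang g in let x := g 0 2 in let y := g 1 2 in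
  mx_of_rows 1 3 [:: [:: IK1 theta x y; IK2 theta x y; IK3 theta x y]].

End IK.
End Defs.

(* Main.v *)
Require Import Defs.
From mathcomp Require Import all_boot all_order all_algebra.
From mathcomp Require Import all_classical all_reals all_analysis.
From mathcomp Require Import ring lra.
Import Order.TTheory GRing.Theory Num.Theory.
Import numFieldNormedType.Exports.
Local Open Scope classical_set_scope.
Local Open Scope ring_scope.

(** Each [V_i] satisfies [A ^+ 3 = - A], so its exponential is given by a Rodrigues formula and is a
    rotation by [t] about a fixed centre. Multiplying three of them ([FK121E]), the angles add up to
    [theta], and the translation is that of the rotation by [theta] generated by [V_1], plus the
    product of the nonzero complex number [(c1 - c2) - i (b1 - b2)] with
    [e^(i t1) - e^(i (t1 + t2))]. Dividing by that number turns the problem into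
    [e^(i t1) (1 - e^(i t2)) = alpha + i beta]. A difference of two unit vectors has length at most
    2, and [IK_rho_sqr_le4] shows that [U] ensures this bound; the isosceles triangle with sides 1,
    1, [rho] then yields [t1] and [t2] ([cos_sin_IK12]), and [t3] completes the angle. *)

Section MatrixExponential.
Context {R : realType} {n : nat}.
Implicit Types (A : 'M[R]_n.+1) (t : R).

(** Up to sign, odd powers of [A] are [A] and positive even powers are [A ^+ 2]. The first summand
    corrects [k = 0], where the cosine term gives [- A ^+ 2] instead of [1]. *)
Lemma exprZ_cube_opp A t (k : nat) : A ^+ 3 = - A ->
  k`!%:R^-1 *: (t *: A) ^+ k =
  (k == 0%N)%:R *: (1 + A ^+ 2) + sin_coeff t k *: A - cos_coeff t k *: A ^+ 2.
Proof.
move=> A3.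
have Aodd j : A ^+ j.*2.+1 = (-1) ^+ j *: A.
  elim: j => [|j IHj]; first by rewrite expr0 scale1r.
  rewrite doubleS -addn2 exprD IHj -scalerAl -exprS A3.
  by rewrite exprS scalerN mulN1r scaleNr.
have Aeven j : A ^+ j.+1.*2 = - (-1) ^+ j.+1 *: A ^+ 2.
  by rewrite doubleS exprSr Aodd -scalerAl -expr2 [(-1) ^+ j.+1]exprS mulN1r opprK.
rewrite /sin_coeff /cos_coeff /= -exprnP exprZn scalerA.
have [[j ->]|[j ->]] : (exists j, k = j.*2.+1) \/ exists j, k = j.*2.
  rewrite -(odd_double_half k); case: (odd k); [left|right]; by exists k./2.
- rewrite Aodd /= odd_double /= !mul0r !scale0r add0r subr0 mul1r doubleK scalerA.
  by congr (_ *: A); ring.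
- rewrite odd_double doubleK !mul0r scale0r addr0 mul1r.
  case: j => [|j]; last first.
    by rewrite Aeven scale0r add0r scalerA -scaleNr; congr (_ *: A ^+ 2); ring.
  by rewrite !expr0 fact0 invr1 !mul1r !scale1r addrK.
Qed.

Lemma cvg_series_unit_coeff : series (fun k => (k == 0%N)%:R : R) @ \oo --> (1 : R).
Proof.
rewrite -(cvg_shiftS _); apply: (@cvg_trans _ ((fun=> 1 : R) @ \oo)); last exact: cvg_cst.
apply: near_eq_cvg; apply: nearW => k.
by rewrite seriesEnat /= big_nat_recl // big1_seq ?addr0.
Qed.

Lemma expmx_cube_opp A t : A ^+ 3 = - A ->
  expmx (t *: A) = 1 + sin t *: A + (1 - cos t) *: A ^+ 2.
Proof.
move=> A3; rewrite /expmx.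
set u := series _.
have -> : u = (fun k => series (fun k => (k == 0%N)%:R : R) k *: (1 + A ^+ 2))
      + (fun k => series (sin_coeff t) k *: A)
      - (fun k => series (cos_coeff t) k *: A ^+ 2).
  apply/funext => k; rewrite /u !fctE !seriesEnat /=.
  rewrite !scaler_suml -big_split -sumrB /=.
  by apply: eq_bigr => i _; rewrite exprZ_cube_opp.
suff -> : 1 + sin t *: A + (1 - cos t) *: A ^+ 2 =
  (1 : R) *: (1 + A ^+ 2) + sin t *: A - cos t *: A ^+ 2.
  apply: cvg_lim => //; apply: cvgB; first apply: cvgD; apply: cvgZr_tmp.
  - exact: cvg_series_unit_coeff.
  - rewrite unlock; exact: is_cvg_series_sin_coeff.
  - rewrite unlock; exact: is_cvg_series_cos_coeff.
by rewrite scale1r scalerBl scale1r; rewrite -!addrA; congr (_ + _); rewrite addrCA.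
Qed.

End MatrixExponential.

Section SE2.
Context {R : realType}.
Implicit Types (a b c t x y : R).

Lemma SE2_mxM a x y a' x' y' :
  SE2_mx a x y *m SE2_mx a' x' y' =
  SE2_mx (a + a') (cos a * x' - sin a * y' + x) (sin a * x' + cos a * y' + y).
Proof.
apply/matrixP => -[[|[|[|//]]] ?] [[|[|[|//]]] ?];
  by rewrite !mxE !big_ord_recl big_ord0 !mxE /= ?cosD ?sinD; ring.
Qed.

Lemma se2_mx_sqr b c : se2_mx 1 b c ^+ 2 =
  mx_of_rows 3 3 [:: [:: -1; 0; - c]; [:: 0; -1; b]; [:: 0; 0; 0]].
Proof.
apply/matrixP => -[[|[|[|//]]] ?] [[|[|[|//]]] ?];
  by rewrite !mxE !big_ord_recl big_ord0 !mxE /=; ring.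
Qed.

Lemma se2_mx_cube b c : se2_mx 1 b c ^+ 3 = - se2_mx 1 b c.
Proof.
rewrite exprS se2_mx_sqr.
apply/matrixP => -[[|[|[|//]]] ?] [[|[|[|//]]] ?];
  by rewrite !mxE !big_ord_recl big_ord0 !mxE /=; ring.
Qed.

Lemma expmx_se2 t b c : expmx (t *: se2_mx 1 b c) =
  SE2_mx t (- c * (1 - cos t) + b * sin t) (b * (1 - cos t) + c * sin t).
Proof.
rewrite expmx_cube_opp ?se2_mx_cube// se2_mx_sqr.
apply/matrixP => -[[|[|[|//]]] ?] [[|[|[|//]]] ?];
  by rewrite !mxE /=; ring.
Qed.

(* Identifying the plane with the complex numbers and [p_i = i (b_i + i c_i)] being
   the centre of the rotations generated by [V_i], the translation part is
   [(1 - e^(i theta)) p_1 + e^(i t1) (e^(i t2) - 1) (p_1 - p_2)], with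
   [theta = t1 + t2 + t3]. *)
Lemma FK121E b1 c1 b2 c2 (t : 'rV[R]_3) :
  let t1 := t 0 0 in let t2 := t 0 1 in let theta := t1 + t2 + t 0 2 in
  let u := cos t1 - cos (t1 + t2) in let v := sin t1 - sin (t1 + t2) in
  FK121 (se2_mx 1 b1 c1) (se2_mx 1 b2 c2) t =
  SE2_mx theta
    (- c1 * (1 - cos theta) + b1 * sin theta
      + (c1 - c2) * u + (b1 - b2) * v)
    (b1 * (1 - cos theta) + c1 * sin theta
      + (c1 - c2) * v - (b1 - b2) * u).
Proof.
rewrite /FK121 !expmx_se2 !SE2_mxM /=; congr SE2_mx;
  by rewrite !(cosD, sinD); ring.
Qed.

(** Stated with the norm as a factor, this also covers the origin, hence the case [rho = 0] of the
    inverse kinematics. *)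
Lemma arctan2_polar x y :
  enorm x y * cos (arctan2 x y) = x /\ enorm x y * sin (arctan2 x y) = y.
Proof.
have polar_atan : x != 0 ->
    enorm x y * cos (atan (y / x)) = `|x| /\
    enorm x y * sin (atan (y / x)) = y / x * `|x|.
  move=> x0; have nE : enorm x y = `|x| * Num.sqrt (1 + (y / x) ^+ 2).
    rewrite -sqrtr_sqr -sqrtrM ?sqr_ge0//; congr Num.sqrt.
    by field.
  have s0 : 0 < Num.sqrt (1 + (y / x) ^+ 2).
    by rewrite sqrtr_gt0 ltr_pwDl ?sqr_ge0.
  have cE : enorm x y * cos (atan (y / x)) = `|x|.
    by rewrite nE cos_atan mulfK ?gt_eqF.
  have c0 : cos (atan (y / x)) != 0 by rewrite cos_atan invr_neq0 ?gt_eqF.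
  split=> //; have tE := atanK (y / x); rewrite /tan in tE.
  by rewrite -cE -[X in _ = X * _]tE mulrCA divfK.
rewrite /arctan2; case: (ltrgt0P x) => [x0|x0|->].
- have [-> ->] := polar_atan (lt0r_neq0 x0); rewrite gtr0_norm //.
  by rewrite divfK ?gt_eqF.
- have [cE sE] := polar_atan (ltr0_neq0 x0).
  have csE a : a = atan (y / x) + pi \/ a = atan (y / x) - pi ->
      cos a = - cos (atan (y / x)) /\ sin a = - sin (atan (y / x)).
    by case=> ->; rewrite ?cosDpi ?sinDpi// cosB sinB cospi sinpi; split; ring.
  have [-> ->] : cos (if 0 <= y then atan (y / x) + pi else atan (y / x) - pi)
        = - cos (atan (y / x)) /\
      sin (if 0 <= y then atan (y / x) + pi else atan (y / x) - pi)
        = - sin (atan (y / x)).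
    by apply: csE; case: ifP; [left|right].
  by rewrite !mulrN cE sE ltr0_norm// mulrN !opprK divfK ?lt_eqF.
- rewrite /enorm expr0n add0r sqrtr_sqr.
  case: (ltrgt0P y) => [y0|y0|->]; rewrite ?cosN ?sinN ?cos_pihalf ?sin_pihalf.
  + by rewrite mulr0 mulr1.
  + by rewrite mulr0 mulrN1 opprK.
  + by rewrite !mul0r.
Qed.

Lemma enorm_sqr x y : enorm x y ^+ 2 = x ^+ 2 + y ^+ 2.
Proof. by rewrite sqr_sqrtr ?addr_ge0 ?sqr_ge0. Qed.

Lemma sum_sqr_sub_gt0 b1 c1 b2 c2 : b1 <> b2 \/ c1 <> c2 ->
  0 < (c1 - c2) ^+ 2 + (b1 - b2) ^+ 2.
Proof.
move=> hV; rewrite lt0r addr_ge0 ?sqr_ge0// andbT paddr_eq0 ?sqr_ge0//.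
rewrite !sqrf_eq0 !subr_eq0 negb_and.
by case: hV => /eqP ->; rewrite ?orbT.
Qed.

Lemma IK_alphaE b1 c1 b2 c2 theta x y :
  IK_alpha b1 c1 b2 c2 theta x y = ((c1 - c2) ^+ 2 + (b1 - b2) ^+ 2)^-1 *
  ((c1 - c2) * (x - (- c1 * (1 - cos theta) + b1 * sin theta)) +
   (b2 - b1) * (y - (b1 * (1 - cos theta) + c1 * sin theta))).
Proof.
rewrite /IK_alpha /alpha_beta /enorm sqr_sqrtr ?addr_ge0 ?sqr_ge0//.
by rewrite !(mxE, big_ord_recl, big_ord0) /=; ring.
Qed.

Lemma IK_betaE b1 c1 b2 c2 theta x y :
  IK_beta b1 c1 b2 c2 theta x y = ((c1 - c2) ^+ 2 + (b1 - b2) ^+ 2)^-1 *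
  ((b1 - b2) * (x - (- c1 * (1 - cos theta) + b1 * sin theta)) +
   (c1 - c2) * (y - (b1 * (1 - cos theta) + c1 * sin theta))).
Proof.
rewrite /IK_beta /alpha_beta /enorm sqr_sqrtr ?addr_ge0 ?sqr_ge0//.
by rewrite !(mxE, big_ord_recl, big_ord0) /=; ring.
Qed.

(* The triangle inequality for [(x, y)] and the translation
   [(1 - e^(i theta)) p_1], of squared norm [2 (1 - cos theta) |p_1|^2]. *)
Lemma IK_rho_sqr_le4 b1 c1 b2 c2 theta x y :
  b1 <> b2 \/ c1 <> c2 ->
  Num.max (enorm x y ^+ 2) (2 * (1 - cos theta) * enorm b1 c1 ^+ 2)
    <= enorm (c1 - c2) (b1 - b2) ^+ 2 ->
  IK_rho b1 c1 b2 c2 theta x y ^+ 2 <= 4.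
Proof.
move=> hV; rewrite !enorm_sqr ge_max => /andP[hxy htheta].
have D_gt0 := sum_sqr_sub_gt0 _ _ _ _ hV.
rewrite IK_alphaE IK_betaE.
have cs := cos2Dsin2 theta.
set u := - c1 * (1 - cos theta) + b1 * sin theta.
set v := b1 * (1 - cos theta) + c1 * sin theta.
have uv : u ^+ 2 + v ^+ 2 = 2 * (1 - cos theta) * (b1 ^+ 2 + c1 ^+ 2).
  rewrite /u /v; have s2 : sin theta ^+ 2 = 1 - cos theta ^+ 2 by rewrite -cs; ring.
  by ring: s2.
rewrite [X in X <= _](_ : _ =
    ((x - u) ^+ 2 + (y - v) ^+ 2) /
    ((c1 - c2) ^+ 2 + (b1 - b2) ^+ 2)); last first.
  by field; rewrite gt_eqF.
rewrite ler_pdivrMr //.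
(* Parallelogram law: the squared norms of the sum and the difference add up to twice those of
   [(x, y)] and [(u, v)], each at most the denominator. *)
have := sqr_ge0 (x + u); have := sqr_ge0 (y + v).
rewrite -uv in htheta; nra.
Qed.

(* With [e^(i t1) = (rho + i s) / 2 * (alpha + i beta) / rho] and
   [e^(i t2) = (2 - rho^2 + i rho s) / 2], where [s = sqrt (4 - rho^2)], the
   product [e^(i t1) (1 - e^(i t2))] is [alpha + i beta]; it vanishes with
   [rho], in which case the angle of [(alpha, beta)] is irrelevant. *)
Lemma cos_sin_IK12 b1 c1 b2 c2 theta x y :
  IK_rho b1 c1 b2 c2 theta x y ^+ 2 <= 4 ->
  let t1 := IK1 b1 c1 b2 c2 theta x y in
  let t2 := IK2 b1 c1 b2 c2 theta x y in
  cos t1 - cos (t1 + t2) = IK_alpha b1 c1 b2 c2 theta x y /\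
  sin t1 - sin (t1 + t2) = IK_beta b1 c1 b2 c2 theta x y.
Proof.
rewrite /IK1 /IK2 /=; set a := IK_alpha _ _ _ _ _ _ _.
set b := IK_beta _ _ _ _ _ _ _; set r := IK_rho _ _ _ _ _ _ _ => r4.
have rE : enorm a b = r by [].
set s := Num.sqrt (4 - r ^+ 2).
have s2 : s ^+ 2 = 4 - r ^+ 2 by rewrite sqr_sqrtr ?subr_ge0.
(* Both [(r, s)] and [(2 - r ^+ 2, r * s)] lie on the circle of radius 2, as
   [r ^+ 2 + s ^+ 2 = 4]. *)
have enorm2 p q : p ^+ 2 + q ^+ 2 = 2 ^+ 2 -> enorm p q = 2.
  by move=> pq; rewrite /enorm pq sqrtr_sqr ger0_norm.
have [] := arctan2_polar a b; rewrite rE.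
have [] := arctan2_polar r s; rewrite enorm2; last by rewrite s2; ring.
have [] := arctan2_polar (2 - r ^+ 2) (r * s).
rewrite enorm2; last by rewrite exprMn s2; ring.
set p := arctan2 _ _; set q := arctan2 _ _; set w := arctan2 _ _.
move=> cp sp cq sq aE bE; rewrite !(cosD, sinD).
have {cp}-> : cos p = 1 - r ^+ 2 / 2 by lra.
have {sp}-> : sin p = r * s / 2 by lra.
have {cq}-> : cos q = r / 2 by lra.
have {sq}-> : sin q = s / 2 by lra.
by split; [rewrite -aE|rewrite -bE]; field: s2.
Qed.

End SE2.

Theorem mainTheorem3 (R : realType) (b1 c1 b2 c2 : R)
    (hV : b1 <> b2 \/ c1 <> c2)
    (ang : 'M[R]_3 -> R) (hang : angle_choice ang) :
  let V1 := se2_mx 1 b1 c1 in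
  let V2 := se2_mx 1 b2 c2 in
  let U := U_nbhd b1 c1 b2 c2 in
  within SE2 (nbhs (1 : 'M[R]_3)) U /\
  (forall g : 'M[R]_3, U g -> FK121 V1 V2 (IK b1 c1 b2 c2 ang g) = g).
Proof.
move=> V1 V2 U; have D_gt0 := sum_sqr_sub_gt0 _ _ _ _ hV; split.
(* Written with matrix entries, both quantities bounded in [U] are continuous; they vanish at the
   identity, where the bound is positive. *)
- pose dist (g : 'M[R]_3) := g 0 2 ^+ 2 + g 1 2 ^+ 2.
  pose rot (g : 'M[R]_3) := 2 * (1 - g 0 0) * (b1 ^+ 2 + c1 ^+ 2).
  have coef i j : (fun g : 'M[R]_3 => g i j) @ (1 : 'M[R]_3)
      --> (1 : 'M[R]_3) i j by exact: coord_continuous.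
  have dist_cvg : dist @ (1 : 'M[R]_3) --> dist 1.
    exact: (cvgD (cvgM (coef 0 2) (coef 0 2)) (cvgM (coef 1 2) (coef 1 2))).
  have rot_cvg : rot @ (1 : 'M[R]_3) --> rot 1.
    exact: (cvgM (cvgM (cvg_cst _) (cvgB (cvg_cst _) (coef 0 0))) (cvg_cst _)).
  have dist_lt : dist 1 < (c1 - c2) ^+ 2 + (b1 - b2) ^+ 2.
    by rewrite /dist !mxE /= expr0n addr0.
  have rot_lt : rot 1 < (c1 - c2) ^+ 2 + (b1 - b2) ^+ 2.
    by rewrite /rot !mxE /= subrr mulr0 mul0r.
  have dist_near : \forall g \near (1 : 'M[R]_3),
      dist g <= (c1 - c2) ^+ 2 + (b1 - b2) ^+ 2 by exact: (cvgr_le _ dist_cvg).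
  have rot_near : \forall g \near (1 : 'M[R]_3),
      rot g <= (c1 - c2) ^+ 2 + (b1 - b2) ^+ 2 by exact: (cvgr_le _ rot_cvg).
  rewrite /within /=; near=> g => -[theta [x [y gE]]].
  exists theta, x, y; split=> //; rewrite !enorm_sqr ge_max.
  have : dist g <= (c1 - c2) ^+ 2 + (b1 - b2) ^+ 2 by near: g.
  have : rot g <= (c1 - c2) ^+ 2 + (b1 - b2) ^+ 2 by near: g.
  by rewrite /dist /rot gE !mxE /= => -> ->.
- move=> g [theta [x [y [gE hU]]]].
  have hg : SE2 g by exists theta, x, y.
  have gangE := hang g hg.
  (* The angle witnessing [U g] may differ from [ang g], but the condition sees it only through its
     cosine. *)
  have cosE : cos theta = cos (ang g).
    by move/matrixP/(_ 0 0): gangE; rewrite {1}gE !mxE.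
  have [xE yE] : x = g 0 2 /\ y = g 1 2 by rewrite gE !mxE.
  rewrite cosE xE yE in hU.
  have [cE sE] := cos_sin_IK12 _ _ _ _ _ _ _ (IK_rho_sqr_le4 _ _ _ _ _ _ _ hV hU).
  rewrite FK121E /IK !mxE /= cE sE [in RHS]gangE.
  rewrite IK_alphaE IK_betaE /IK3.
  have -> (p q r : R) : p + q + (r - p - q) = r by ring.
  (* What remains is that [alpha] and [beta] solve the linear system of [FK121E], whose determinant
     is the positive [D_gt0] quantity. *)
  by congr SE2_mx; field; rewrite gt_eqF.
Unshelve. all: by end_near.
Qed.
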